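(* Suppose the pricing kernel $S$ admits a recurrent eigenfunction $\pi_R$, with $\mathscr{P}_t\pi_R=e^{-\lambda_R t}\pi_R$, and let $\mathbb{Q}^{\pi_R}$ be the associated recurrent eigen-measure. Suppose further that there exist a probability measure $\varsigma$ on $E$, a Borel function $\beta(x)$ and positive constants $\alpha$ and $t_0$ such that for all bounded Borel functions $f$, $$\left|\mathbb{E}^{\mathbb{Q}^{\pi_R}}_x\!\left[\frac{f(X_t)}{\pi_R(X_t)}\right]-c_f\right|\le \beta(x)\|f\|_\infty e^{-\alpha t}$$ for all $t\ge t_0$ and each $x\in E$, where $$c_f=\int_E\frac{f(y)}{\pi_R(y)}\,\varsigma(dy).$$ Then for any bounded Borel payoff $f$, each $x\in E$ and all $t\ge t_0$, $$\left|\mathscr{P}_tf(x)-c_fe^{-\lambda_Rt}\pi_R(x)\right|\le\beta(x)\pi_R(x)\|f\|_\infty e^{-(\lambda_R+\alpha)t}.$$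
   Context: $E$ is a Lusin space (homeomorphic to a Borel subset of a compact metric space) having at least two points, with Borel sigma-field $\mathscr{E}$; $\mathscr{E}^*$ is the sigma-field of universally measurable subsets. $X=(\Omega,\mathscr{F},(\mathscr{F}_t)_{t\ge0},(X_t)_{t\ge0},(\mathbb{P}_x)_{x\in E})$ is a conservative Borel right process on $E$ (time-homogeneous strong Markov process with right-continuous paths, shift operators $\theta_t$, Borel transition function, $\mathbb{P}_x(X_0=x)=1$, $\mathbb{P}_x(X_t\in E)=1$), $(\mathscr{F}_t)$ being its minimum augmented admissible filtration. The pricing kernel $S$ is a strictly positive semimartingale (under every $\mathbb{P}_x$) with $S_0=1$, $S_->0$, $S_{t+s}(\omega)=S_t(\omega)S_s(\theta_t\omega)$ and $\mathbb{E}^{\mathbb P}_x[S_t]<\infty$ for all $t>0,x\in E$; the pricing operators are $\mathscr{P}_tf(x)=\mathbb{E}^{\mathbb P}_x[S_tf(X_t)]$. If $\pi$ is a strictly positive finite Borel function with $\mathscr{P}_t\pi=e^{-\lambda t}\pi$ for all $t\ge0$ and some real $\lambda$, then $M^\pi_t=e^{\lambda t}\frac{\pi(X_t)}{\pi(X_0)}S_t$ is a positive martingale and the eigen-measure $\mathbb{Q}^\pi=(\mathbb{Q}^\pi_x)_{x\in E}$ is defined by $\mathbb{Q}^\pi_x|_{\mathscr{F}_t}=M^\pi_t\mathbb{P}_x|_{\mathscr{F}_t}$. Such a $\pi$ is called a recurrent eigenfunction (and $\mathbb{Q}^\pi$ a recurrent eigen-measure) if $X$ is recurrent under $\mathbb{Q}^\pi$: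 for each $B\in\mathscr{E}^*$, $R^\pi(x,B)=\int_0^\infty\mathbb{Q}^\pi_x(X_t\in B)\,dt$ is either $0$ for all $x\in E$ or $\infty$ for all $x\in E$. *)

(* Defs.v *)
From HB Require Import structures.
From mathcomp Require Import all_boot all_order all_algebra.
From mathcomp Require Import all_classical all_reals all_analysis.
From mathcomp Require Import measurable_realfun.

Set Implicit Arguments.
Unset Strict Implicit.
Unset Printing Implicit Defensive.
Import Order.TTheory GRing.Theory Num.Theory.
Import numFieldNormedType.Exports.

Local Open Scope classical_set_scope.
Local Open Scope ring_scope.

Notation borel E := (g_sigma_algebraType (@open E)).

Definition lusin (R : realType) (E : ptopologicalType) : Prop :=
  exists (K : metricType R) (i : E -> K),
    [/\ compact [set: K], <<s @open K >> (range i), injective i &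
        forall U : set E, open U <-> exists2 V, open V & U = i @^-1` V].

Definition completion (R : realType) (T : Type) (G : set (set T))
    (m : set T -> \bar R) : set (set T) :=
  [set A | exists B C,
    [/\ G B, G C, B `<=` A, A `<=` C & m (C `\` B) = 0%E]].

Definition univ_measurable (R : realType) (E : ptopologicalType) :
    set (set E) :=
  [set B | forall mu : probability (borel E) R, completion measurable mu B].

Definition supnorm (R : realType) (T : Type) (f : T -> R) : R :=
  sup (range (fun x => `|f x|)).

(* All processes and filtrations are indexed by R; only times t >= 0 are ever
   used. *)
Section processes.
Context {R : realType} {d : measure_display} {Omega : measurableType d}.
Implicit Types (F : R -> set (set Omega)) (P : probability Omega R).

Definition adapted F (Y : R -> Omega -> R) : Prop :=
  forall t, 0 <= t -> forall B : set R, measurable B -> F t (Y t @^-1` B).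

Definition cadlag (y : R -> R) : Prop :=
  (forall t, 0 <= t -> y s @[s --> t^'+] --> y t) /\
  (forall t, 0 < t -> cvg (y s @[s --> t^'-])).

Definition stopping_time F (T : Omega -> \bar R) : Prop :=
  (forall w, (0 <= T w)%E) /\
  forall t, 0 <= t -> F t [set w | (T w <= t%:E)%E].

Definition stopped_sigma F (T : Omega -> \bar R) : set (set Omega) :=
  [set A | measurable A /\
    forall t, 0 <= t -> F t (A `&` [set w | (T w <= t%:E)%E])].

Definition stopped (Y : R -> Omega -> R) (T : Omega -> \bar R) :
    R -> Omega -> R :=
  fun t w => Y (fine (Order.min t%:E (T w))) w.

Definition martingale F P (M : R -> Omega -> R) : Prop :=
  [/\ adapted F M,
      forall t, 0 <= t -> P.-integrable [set: Omega] (EFin \o M t) &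
      forall s t, 0 <= s -> s <= t -> forall A, F s A ->
        (\int[P]_(w in A) (M t w)%:E = \int[P]_(w in A) (M s w)%:E)%E].

(* Null at time 0. Since the filtration used below need not contain all
   P-negligible sets, path properties are only required almost surely. *)
Definition local_martingale0 F P (M : R -> Omega -> R) : Prop :=
  [/\ adapted F M,
      {ae P, forall w, M 0 w = 0 /\ cadlag (M ^~ w)} &
      exists T : nat -> Omega -> \bar R,
        [/\ forall n, stopping_time F (T n),
            {ae P, forall w, nondecreasing_seq (T ^~ w) /\
                             T n w @[n --> \oo] --> (+oo)%E} &
            forall n, martingale F P (stopped M (T n))]].

Definition finite_variation0 F P (A : R -> Omega -> R) : Prop :=
  adapted F A /\
  {ae P, forall w, [/\ A 0 w = 0, cadlag (A ^~ w) &
                       forall t, 0 <= t -> bounded_variation 0 t (A ^~ w)]}.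

Definition semimartingale F P (S : R -> Omega -> R) : Prop :=
  [/\ adapted F S, (forall w, cadlag (S ^~ w)) &
      exists M A : R -> Omega -> R,
        [/\ local_martingale0 F P M, finite_variation0 F P A &
            {ae P, forall w, forall t, 0 <= t ->
                     S t w = S 0 w + M t w + A t w}]].

End processes.

Section markov.
Context {R : realType} {E : ptopologicalType}
        {d : measure_display} {Omega : measurableType d}.
Variables (X : R -> Omega -> E) (theta : R -> Omega -> Omega)
          (P : E -> probability Omega R).

(* sigma(X_s, 0 <= s <= t) and sigma(X_s, 0 <= s), without completion *)
Definition natural (t : R) : set (set Omega) :=
  <<s [set A | exists s (B : set (borel E)),
         [/\ 0 <= s, s <= t, measurable B & A = X s @^-1` B]] >>.

Definition natural_infty : set (set Omega) :=
  <<s [set A | exists s (B : set (borel E)),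
         [/\ 0 <= s, measurable B & A = X s @^-1` B]] >>.

Definition initial_law (mu : probability (borel E) R) (A : set Omega) :
    \bar R :=
  (\int[mu]_x P x A)%E.

Definition null_sets (mu : probability (borel E) R) : set (set Omega) :=
  [set A | exists C,
    [/\ natural_infty C, A `<=` C & initial_law mu C = 0%E]].

(* the minimum augmented admissible filtration (F_t) *)
Definition augmented (t : R) : set (set Omega) :=
  [set A | forall mu : probability (borel E) R,
    <<s natural t `|` null_sets mu >> A].

(* The process takes its values in E, so that conservativeness is built into
   the type of X: there is no cemetery state. [measurable] on Omega plays the
   role of the sigma-field F, the intersection over mu of the completions
   under P^mu of sigma(X_s, 0 <= s). The strong Markov property is required
   for (F_t) together with the right-continuity of (F_t); without the latter
   it would be strictly weaker than the one defining right processes.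
   brp_kernel contains the Borel measurability of the transition function
   P_x(X_t \in B) in x. *)
Record borel_right_process : Prop := BorelRightProcess {
  brp_sigma_field : forall A : set Omega, measurable A <->
    forall mu : probability (borel E) R,
      completion natural_infty (initial_law mu) A ;
  brp_right_continuous : forall w (t : R), 0 <= t -> X s w @[s --> t^'+] --> X t w ;
  brp_shift : forall (s t : R) w, 0 <= s -> 0 <= t -> X s (theta t w) = X (t + s) w ;
  brp_shiftD : forall (s t : R) w, 0 <= s -> 0 <= t ->
    theta s (theta t w) = theta (t + s) w ;
  brp_kernel : forall A, natural_infty A ->
    measurable_fun [set: borel E] (fun x : borel E => P x A) ;
  brp_normal : forall x, P x (X 0 @^-1` [set x]) = 1%E ;
  brp_filtration : forall t, 0 <= t ->
    augmented t = [set A | forall s, t < s -> augmented s A] ;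
  brp_strong_markov : forall x (T : Omega -> \bar R) (A : set Omega) s
      (B : set (borel E)),
    stopping_time augmented T -> stopped_sigma augmented T A ->
    0 <= s -> measurable B ->
    let D := A `&` [set w | (T w < +oo)%E] in
    (P x (D `&` [set w | B (X (fine (T w) + s)%R w)])
     = \int[P x]_(w in D) P (X (fine (T w)) w) (X s @^-1` B))%E
}.

Record pricing_kernel (S : R -> Omega -> R) : Prop := PricingKernel {
  pk_semimartingale : forall x, semimartingale augmented (P x) S ;
  pk_gt0 : forall (t : R) w, 0 <= t -> 0 < S t w ;
  pk_left_gt0 : forall (t : R) w, 0 < t -> 0 < lim (S s w @[s --> t^'-]) ;
  pk_init : forall w, S 0 w = 1 ;
  pk_mul : forall (s t : R) w, 0 <= s -> 0 <= t ->
    S (t + s) w = S t w * S s (theta t w) ;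
  pk_integrable : forall (t : R) x, 0 < t -> (\int[P x]_w (S t w)%:E < +oo)%E
}.

Definition pricing_op (S : R -> Omega -> R) (t : R) (f : E -> R) (x : E) :
    \bar R :=
  (\int[P x]_w (S t w * f (X t w))%:E)%E.

Definition positive_eigenfunction (S : R -> Omega -> R) (pi : E -> R)
    (lambda : R) : Prop :=
  [/\ measurable_fun [set: borel E] (pi : borel E -> R),
      forall x, 0 < pi x &
      forall (t : R) x, 0 <= t ->
        pricing_op S t pi x = (expR (- (lambda * t)) * pi x)%:E].

Definition eigen_density (S : R -> Omega -> R) (pi : E -> R) (lambda t : R)
    (w : Omega) : R :=
  expR (lambda * t) * (pi (X t w) / pi (X 0 w)) * S t w.

(* Omega with the sigma-field sigma(X_s, 0 <= s), on which eigen-measures are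
   defined *)
Local Notation raw_space := (g_sigma_algebraType natural_infty).

(* The density relation is imposed on sigma(X_s, s <= t) rather than on the
   augmented F_t: F_0 already contains the events of sigma(X_s, 0 <= s) that
   are null under every P^mu, whereas Q_x is in general singular to P_x on
   sigma(X_s, 0 <= s), so on F_t the relation usually has no countably
   additive solution. Any solution on (F_t) restricts to one in the present
   sense, and the present one is unique. *)
Definition eigen_measure (S : R -> Omega -> R) (pi : E -> R) (lambda : R)
    (Q : E -> probability raw_space R) : Prop :=
  forall x t (A : set Omega), 0 <= t -> natural t A ->
    (Q x A = \int[P x]_(w in A) (eigen_density S pi lambda t w)%:E)%E.

(* For B universally measurable, X_t^-1(B) belongs to the completion of
   sigma(X_s, 0 <= s) under Q x, and the outer measure (Q x)^* is the completed
   measure there. The integrand is Lebesgue measurable, possibly not Borel; the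
   integral, a supremum over simple functions below it, is still the Lebesgue
   integral. *)
Definition potential (Q : E -> probability raw_space R) (x : E) (B : set E) :
    \bar R :=
  (\int[lebesgue_measure]_(t in `[0%R, +oo[)
     mu_ext (Q x) (X t @^-1` B : set raw_space))%E.

Definition recurrent (Q : E -> probability raw_space R) : Prop :=
  forall B, univ_measurable R B ->
    (forall x, potential Q x B = 0%E) \/ (forall x, potential Q x B = (+oo)%E).

End markov.

Notation raw_space X := (g_sigma_algebraType (natural_infty X)).

Definition limit_coef (R : realType) (E : ptopologicalType) (pi : E -> R)
    (vs : probability (borel E) R) (f : E -> R) : \bar R :=
  (\int[vs]_y (f y / pi y)%:E)%E.

(* Main.v *)
(** Since [X_0 = x] almost surely under [P_x], the density of the eigen-measure
    satisfies [S_t = e^(-lambda t) pi(x) / pi(X_t) * M_t], hence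
    [P_t f(x) = e^(-lambda t) pi(x) E^Q_x[f(X_t) / pi(X_t)]], and the bound is
    the ergodicity hypothesis multiplied by [e^(-lambda t) pi(x)].

    [Q_x] and [P_x] are measures on different sigma-fields, and [S_t] is
    measurable only for the augmented one, so the change of measure is carried
    out on the law of [X_t]; it needs the augmented filtration to consist of
    measurable sets, i.e. the completions under the initial laws to be
    sigma-fields. *)

Require Import Defs.
From HB Require Import structures.
From mathcomp Require Import all_boot all_order all_algebra.
From mathcomp Require Import all_classical all_reals all_analysis.
From mathcomp Require Import measurable_realfun.
From mathcomp Require Import ring.

Set Implicit Arguments.
Unset Strict Implicit.
Unset Printing Implicit Defensive.
Import Order.TTheory GRing.Theory Num.Theory.
Import numFieldNormedType.Exports.

Local Open Scope classical_set_scope.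
Local Open Scope ring_scope.

(** * Change of measure on the law of a random element *)

Import HBNNSimple.

(** [nuE] is the case of an indicator [g]; linearity and monotone convergence do the rest. Only
    image measures on [U] are compared, so [mu] and [nu] may live on different sigma-fields, as
    [P x] and [Q x] do. *)
Lemma ge0_integral_density_comp d d' d'' (T : measurableType d)
    (T' : measurableType d') (U : measurableType d'') (R : realType)
    (mu : {measure set T -> \bar R}) (nu : {measure set T' -> \bar R})
    (phi : T -> U) (psi : T' -> U) (D : T -> R) (g : U -> \bar R) :
  measurable_fun [set: T] phi -> measurable_fun [set: T'] psi ->
  measurable_fun [set: T] D -> (forall w, 0 <= D w) ->
  (forall B, measurable B ->
    nu (psi @^-1` B) = \int[mu]_(w in phi @^-1` B) (D w)%:E)%E ->
  measurable_fun [set: U] g -> (forall u, 0 <= g u)%E ->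
  (\int[nu]_v g (psi v) = \int[mu]_w (g (phi w) * (D w)%:E))%E.
Proof.
move=> mphi mpsi mD D0 nuE mg g0.
pose h : {nnsfun U >-> R}^nat := nnsfun_approx measurableT mg.
have mhD n : measurable_fun setT (fun w : T => ((h n (phi w))%:E * (D w)%:E)%E).
  apply: emeasurable_funM; last exact/measurable_EFinP.
  by apply/measurable_EFinP; exact: measurableT_comp.
have lhs : (\int[nu]_v (h n (psi v))%:E @[n --> \oo]
    --> \int[nu]_v g (psi v))%E.
  rewrite [X in _ --> X](_ : _ =
      \int[nu]_v limn (fun n => (h n (psi v))%:E))%E; last first.
    apply: eq_integral => v _.
    by apply/esym/cvg_lim => //; exact: cvg_nnsfun_approx.
  apply: cvg_monotone_convergence => //.
  - by move=> n; apply/measurable_EFinP; exact: measurableT_comp.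
  - by move=> n v _; rewrite lee_fin.
  - by move=> v _ m n mn; rewrite lee_fin; apply/lefP/nd_nnsfun_approx.
have rhs : (\int[mu]_w ((h n (phi w))%:E * (D w)%:E) @[n --> \oo]
    --> \int[mu]_w (g (phi w) * (D w)%:E))%E.
  rewrite [X in _ --> X](_ : _ =
      \int[mu]_w limn (fun n => (h n (phi w))%:E * (D w)%:E))%E; last first.
    apply: eq_integral => w _; apply/esym/cvg_lim => //.
    by apply: cvgeZr => //; exact: cvg_nnsfun_approx.
  apply: cvg_monotone_convergence => //.
  - by move=> n w _; rewrite mule_ge0// lee_fin.
  - move=> w _ m n mn; rewrite lee_wpmul2r ?lee_fin//.
    exact/lefP/nd_nnsfun_approx.
(* Both sides are limits along the same simple functions [h n], so equality for each [n] is
   enough. *)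
apply: cvg_unique lhs _ => //.
apply: cvg_trans rhs; apply: near_eq_cvg; apply: nearW => n; apply/esym.
have mphi1 y : measurable (phi @^-1` (h n @^-1` [set y])).
  by rewrite -[X in measurable X]setTI; exact: mphi.
have mpsi1 y : measurable (psi @^-1` (h n @^-1` [set y])).
  by rewrite -[X in measurable X]setTI; exact: mpsi.
have mind1 y :
    measurable_fun setT (fun w => \1_(h n @^-1` [set y]) (phi w) : R).
  exact: (measurableT_comp (measurable_indic _)).
have mind2 y :
    measurable_fun setT (fun v => \1_(h n @^-1` [set y]) (psi v) : R).
  exact: (measurableT_comp (measurable_indic _)).
under eq_integral do rewrite fimfunE -fsumEFin//.
rewrite ge0_integral_fsum//; last 2 first.
- by move=> y; apply/measurable_EFinP; apply: measurable_funM.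
- by move=> y v _; rewrite EFinM nnfun_muleindic_ge0.
under [RHS]eq_integral.
  move=> w _; rewrite fimfunE -fsumEFin// ge0_mule_fsuml.
    over.
  by move=> y; rewrite EFinM nnfun_muleindic_ge0.
rewrite ge0_integral_fsum//; last 2 first.
- move=> y; apply: emeasurable_funM; apply/measurable_EFinP => //.
  exact: measurable_funM.
- move=> y w _; apply: mule_ge0; last by rewrite lee_fin.
  by rewrite EFinM nnfun_muleindic_ge0.
(* Writing the value [y] as [h n u] shows that it is non-negative, which allows it to leave the
   integrals. *)
apply: eq_fsbigr => y; rewrite inE => -[u _ <-].
under eq_integral do rewrite EFinM.
under [RHS]eq_integral do rewrite EFinM -muleA.
rewrite !ge0_integralZl ?lee_fin//.
- congr (_ * _)%E; rewrite (integral_indic _ measurableT (mpsi1 _)) setIT nuE//.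
  rewrite integral_mkcond; apply: eq_integral => w _.
  rewrite patchE indicE; case: ifPn => [|] wi.
    by rewrite mem_set ?mul1e//; move: wi; rewrite inE.
  by rewrite memNset ?mul0e//; move/negP: wi; rewrite inE.
- by apply: emeasurable_funM; exact/measurable_EFinP.
- by move=> w _; rewrite mule_ge0// lee_fin.
- exact/measurable_EFinP.
Qed.

Lemma integral_funrposneg d (T : measurableType d) (R : realType)
    (mu : {measure set T -> \bar R}) (D : set T) (g : T -> R) :
  (\int[mu]_(w in D) (g w)%:E =
   \int[mu]_(w in D) (g^\+ w)%:E - \int[mu]_(w in D) (g^\- w)%:E)%E.
Proof. by rewrite integralE funerpos funerneg. Qed.

(** * Measurability with respect to the completed and augmented sigma-fields *)

Section measurability.
Context {R : realType} {E : ptopologicalType}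
  {d : measure_display} {Omega : measurableType d}.
Variables (X : R -> Omega -> E) (theta : R -> Omega -> Omega)
  (P : E -> probability Omega R).
Hypothesis X_right : borel_right_process X theta P.

Lemma natural_infty_sigma_algebra : sigma_algebra setT (natural_infty X).
Proof. exact: smallest_sigma_algebra. Qed.

Lemma natural_infty0 : natural_infty X set0.
Proof. by case: natural_infty_sigma_algebra. Qed.

Lemma natural_inftyC A : natural_infty X A -> natural_infty X (~` A).
Proof.
by rewrite -setTD; case: natural_infty_sigma_algebra => _ + _; exact.
Qed.

Lemma natural_infty_bigcup (A : (set Omega)^nat) :
  (forall n, natural_infty X (A n)) -> natural_infty X (\bigcup_n A n).
Proof. by case: natural_infty_sigma_algebra => _ _; exact. Qed.

Lemma natural_inftyD A B : natural_infty X A -> natural_infty X B ->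
  natural_infty X (A `\` B).
Proof. exact: (@measurableD _ (g_sigma_algebraType _)). Qed.

Lemma initial_law_set0 mu : initial_law P mu set0 = 0%E.
Proof.
rewrite /initial_law; under eq_integral do rewrite measure0.
exact: integral0.
Qed.

Lemma natural_infty_completion mu A : natural_infty X A ->
  completion (natural_infty X) (initial_law P mu) A.
Proof. by exists A, A; split=> //; rewrite setDv initial_law_set0. Qed.

Lemma natural_infty_measurable A : natural_infty X A -> measurable A.
Proof.
by move=> XA; apply/(brp_sigma_field X_right) => mu;
  exact: natural_infty_completion.
Qed.

Lemma natural_sub_infty t : natural X t `<=` natural_infty X.
Proof.
by apply: sub_sigma_algebra2 => _ [s [B [s0 _ mB ->]]]; exists s, B.
Qed.

Lemma natural_preimage t (B : set (borel E)) : 0 <= t -> measurable B ->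
  natural X t (X t @^-1` B).
Proof.
by move=> t0 mB; rewrite /natural; apply: sub_sigma_algebra; exists t, B.
Qed.

(** [initial_law] is a bare set function, so this fact and the next are obtained by integrating the
    corresponding property of each [P x]; [brp_kernel] makes the integrands measurable. *)
Lemma initial_law_subset0 mu A N : natural_infty X A -> natural_infty X N ->
  A `<=` N -> initial_law P mu N = 0%E -> initial_law P mu A = 0%E.
Proof.
move=> XA XN AN PN0; apply/eqP; rewrite eq_le -{1}PN0; apply/andP; split.
  apply: ge0_le_integral => //; try exact: (brp_kernel X_right).
  move=> x _; apply: le_measure => //;
    by rewrite inE; exact: natural_infty_measurable.
by apply: integral_ge0.
Qed.

Lemma initial_law_bigcup0 mu (N : (set Omega)^nat) :
  (forall n, natural_infty X (N n)) ->
  (forall n, initial_law P mu (N n) = 0%E) ->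
  initial_law P mu (\bigcup_n N n) = 0%E.
Proof.
move=> XN PN0.
have XUN : natural_infty X (\bigcup_n N n) by exact: natural_infty_bigcup.
have mN n : measurable (N n) by exact: natural_infty_measurable.
have mPN n := brp_kernel X_right (XN n).
apply/eqP; rewrite eq_le; apply/andP; split; last exact: integral_ge0.
apply: (@le_trans _ _ (\int[mu]_x \sum_(n <oo) P x (N n))%E).
  apply: ge0_le_integral => //.
  - exact: (brp_kernel X_right).
  - by apply: ge0_emeasurable_sum.
  - move=> x _; apply: measure_sigma_subadditive => //.
    exact: natural_infty_measurable.
rewrite integral_nneseries// eseries0// => n _ _.
exact: PN0.
Qed.

Lemma sigma_algebra_completion mu :
  sigma_algebra setT (completion (natural_infty X) (initial_law P mu)).
Proof.
split.
- exact: natural_infty_completion natural_infty0.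
- move=> A [B [C [XB XC BA AC BC0]]]; rewrite setTD.
  (* Complementation swaps the inner and outer bounds and leaves the gap [C] minus [B] unchanged. *)
  exists (~` C), (~` B); split; try exact: natural_inftyC.
  + exact: subsetC.
  + exact: subsetC.
  + by rewrite setDE setCK setIC -setDE.
- move=> A /choice[B] /choice[C] ABC.
  have XB n : natural_infty X (B n) by case: (ABC n).
  have XC n : natural_infty X (C n) by case: (ABC n).
  exists (\bigcup_n B n), (\bigcup_n C n).
  have XBC n : natural_infty X (C n `\` B n) by exact: natural_inftyD.
  split; try exact: natural_infty_bigcup.
  + by apply: subset_bigcup => n _; case: (ABC n).
  + by apply: subset_bigcup => n _; case: (ABC n).
  (* The gap between the two unions is covered by the union of the null gaps. *)
  + apply: (@initial_law_subset0 _ _ (\bigcup_n (C n `\` B n))).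
    * by apply: natural_inftyD; exact: natural_infty_bigcup.
    * exact: natural_infty_bigcup.
    * move=> w [[n _ Cw] Bw]; exists n => //; split=> // Bnw.
      by apply: Bw; exists n.
    * by apply: initial_law_bigcup0 => // n; case: (ABC n).
Qed.

(** For each [mu] the completion is a sigma-algebra containing both kinds of generators: events of
    [natural t], and null sets, which lie between [set0] and a null [C]. [brp_sigma_field] then
    applies. *)
Lemma augmented_measurable t A : augmented X P t A -> measurable A.
Proof.
move=> XA; apply/(brp_sigma_field X_right) => mu.
move: (XA mu); apply: smallest_sub; first exact: sigma_algebra_completion.
move=> B [/natural_sub_infty|[C [XC BC PC0]]].
  exact: natural_infty_completion.
by exists set0, C; split=> //; [exact: natural_infty0|rewrite setD0].
Qed.

Lemma adapted_measurable (Y : R -> Omega -> R) t : 0 <= t ->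
  adapted (augmented X P) Y -> measurable_fun [set: Omega] (Y t).
Proof.
move=> t0 Yad _ B mB; rewrite setTI; apply: (@augmented_measurable t).
exact: Yad.
Qed.

Lemma process_measurable t : 0 <= t ->
  measurable_fun [set: Omega] (X t : Omega -> borel E).
Proof.
move=> t0 _ B mB; rewrite setTI.
apply: natural_infty_measurable; apply: (@natural_sub_infty t).
exact: natural_preimage.
Qed.

Lemma process_raw_measurable t : 0 <= t ->
  measurable_fun [set: raw_space X] (X t : raw_space X -> borel E).
Proof.
move=> t0 _ B mB; rewrite setTI; apply: sub_sigma_algebra.
by apply: (@natural_sub_infty t); exact: natural_preimage.
Qed.

End measurability.

(** The point [i x] is closed in the metric space [K], and injectivity pulls its complement back to
    that of [x]. This makes [X 0 = x] an event. *)
Lemma lusin_measurable_set1 (R : realType) (E : ptopologicalType) (x : E) :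
  lusin R E -> measurable ([set x] : set (borel E)).
Proof.
move=> [K [i [_ _ i_inj i_open]]].
rewrite -[X in measurable X]setCK; apply: measurableC.
apply: sub_sigma_algebra; apply/i_open; exists (~` [set i x]).
  apply: closed_openC; apply: accessible_closed_set1.
  exact/hausdorff_accessible/metric_hausdorff.
apply/seteqP; split=> y /= yx; first by move=> /i_inj.
by move=> yx'; apply: yx; rewrite yx'.
Qed.

(** * The pricing operator expressed through the eigen-measure *)

Section eigen_measure.
Context {R : realType} {E : ptopologicalType}
  {d : measure_display} {Omega : measurableType d}.
Variables (X : R -> Omega -> E) (theta : R -> Omega -> Omega)
  (P : E -> probability Omega R) (S : R -> Omega -> R)
  (piR : E -> R) (lambdaR : R) (Q : E -> probability (raw_space X) R).
Hypotheses (E_lusin : lusin R E) (X_right : borel_right_process X theta P)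
  (S_kernel : pricing_kernel X theta P S)
  (piR_eigen : positive_eigenfunction X P S piR lambdaR)
  (Q_eigen : eigen_measure P S piR lambdaR Q).

Lemma start_ae x : {ae P x, forall w, X 0 w = x}.
Proof.
have mX0 : measurable (X 0 @^-1` [set x]).
  rewrite -[X in measurable X]setTI.
  apply: (process_measurable X_right (lexx 0) measurableT).
  exact: lusin_measurable_set1 E_lusin.
exists (~` (X 0 @^-1` [set x])); split=> //; first exact: measurableC.
by rewrite probability_setC// (brp_normal X_right) subee.
Qed.

Lemma ge0_pricing_op (f : E -> R) t x : 0 <= t ->
  measurable_fun [set: borel E] (f : borel E -> R) -> (forall y, 0 <= f y) ->
  pricing_op X P S t f x = ((expR (- (lambdaR * t)) * piR x)%:E *
    \int[Q x]_w (f (X t w) / piR (X t w))%:E)%E.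
Proof.
move=> t0 mf f0; have [mpi pi0 _] := piR_eigen.
have mS : measurable_fun setT (S t).
  have [Sad _ _] := pk_semimartingale S_kernel x.
  exact: (adapted_measurable X_right).
have S0 w : 0 < S t w by exact: (pk_gt0 S_kernel).
(* Since [piR] is positive, its inverse is the power of exponent -1, a measurable function of
   [piR]. *)
have mpiV : measurable_fun setT (fun y : borel E => (piR y)^-1).
  rewrite (_ : (fun y => _) = (fun y => powR (piR y) (- 1))); last first.
    by apply/funext => y; rewrite powR_inv1// ltW.
  exact: (measurableT_comp (measurable_powR _) mpi).
have mX s := process_measurable X_right (t := s).
pose D := eigen_density X S piR lambdaR t.
have mD : measurable_fun setT D.
  apply: measurable_funM => //; apply: measurable_funM => //.
  apply: measurable_funM.
    exact: (measurableT_comp mpi (mX _ t0)).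
  exact: (measurableT_comp mpiV (mX _ (lexx 0))).
have D0 w : 0 <= D w.
  by rewrite /D /eigen_density !mulr_ge0 ?expR_ge0 ?invr_ge0// ltW.
have mg : measurable_fun setT (fun y : borel E => (f y / piR y)%:E).
  by apply/measurable_EFinP; exact: measurable_funM.
have g0 y : (0 <= (f y / piR y)%:E)%E by rewrite lee_fin divr_ge0// ltW.
(* The density relation holds on [natural t], which contains the preimages of Borel sets under
   [X t]. *)
have QE (B : set (borel E)) : measurable B ->
    (Q x (X t @^-1` B) = \int[P x]_(w in X t @^-1` B) (D w)%:E)%E.
  by move=> mB; apply: Q_eigen => //; exact: natural_preimage.
have -> := ge0_integral_density_comp (mu := P x) (nu := Q x) (mX _ t0)
  (process_raw_measurable t0) mD D0 QE mg g0.
have mgD : measurable_fun setT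
    (fun w => ((f (X t w) / piR (X t w))%:E * (D w)%:E)%E).
  apply: emeasurable_funM; last exact/measurable_EFinP.
  exact: (measurableT_comp mg (mX _ t0)).
have k0 : 0 <= expR (- (lambdaR * t)) * piR x.
  by rewrite mulr_ge0 ?expR_ge0// ltW.
rewrite -ge0_integralZl//; last first.
  by move=> w _; rewrite mule_ge0// lee_fin.
(* The density contains [piR (X 0 w)] and the prefactor [piR x]; they cancel only where [X 0 w = x],
   hence almost everywhere. *)
apply: ge0_ae_eq_integral => //.
- apply/measurable_EFinP; apply: measurable_funM => //.
  exact: (measurableT_comp mf (mX _ t0)).
- exact: measurable_funeM.
- by move=> w _; rewrite lee_fin mulr_ge0// ltW.
- by move=> w _; rewrite mule_ge0// ?mule_ge0// lee_fin.
apply: filterS (start_ae x) => w X0w _.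
rewrite -!EFinM; congr EFin; rewrite /D /eigen_density X0w expRN.
have pit := lt0r_neq0 (pi0 (X t w)); have pix := lt0r_neq0 (pi0 x).
have et := lt0r_neq0 (expR_gt0 (lambdaR * t)).
by field; rewrite pit pix et.
Qed.

(** Multiplying by [S t] or dividing by [piR], both positive, commutes with taking positive and
    negative parts, which reduces to the non-negative case. Finiteness of the positive part excludes
    [oo - oo], so the prefactor distributes over the difference. *)
Lemma pricing_op_eigen_measure (f : E -> R) t x : 0 <= t ->
  measurable_fun [set: borel E] (f : borel E -> R) ->
  (\int[Q x]_w (f^\+ (X t w) / piR (X t w))%:E \is a fin_num)%E ->
  pricing_op X P S t f x = ((expR (- (lambdaR * t)) * piR x)%:E *
    \int[Q x]_w (f (X t w) / piR (X t w))%:E)%E.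
Proof.
move=> t0 mf finp; have [mpi pi0 _] := piR_eigen.
have S0 w : 0 < S t w by exact: (pk_gt0 S_kernel).
have mfp : measurable_fun [set: borel E] (f^\+ : borel E -> R).
  exact: measurable_funrpos.
have mfn : measurable_fun [set: borel E] (f^\- : borel E -> R).
  exact: measurable_funrneg.
have -> : pricing_op X P S t f x =
    (pricing_op X P S t f^\+%R x - pricing_op X P S t f^\-%R x)%E.
  rewrite /pricing_op integral_funrposneg.
  congr (_ - _)%E; apply: eq_integral => w _; congr EFin.
    by rewrite /funrpos maxr_pMr ?mulr0// ltW.
  by rewrite /funrneg maxr_pMr ?mulr0 ?mulrN// ltW.
have -> : (\int[Q x]_w (f (X t w) / piR (X t w))%:E =
    \int[Q x]_w (f^\+ (X t w) / piR (X t w))%:E -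
    \int[Q x]_w (f^\- (X t w) / piR (X t w))%:E)%E.
  rewrite integral_funrposneg.
  congr (_ - _)%E; apply: eq_integral => w _; congr EFin.
    by rewrite /funrpos maxr_pMl ?mul0r// invr_ge0 ltW.
  by rewrite /funrneg maxr_pMl ?mul0r ?mulNr// invr_ge0 ltW.
rewrite [RHS]muleBr//; last exact: fin_num_adde_defr.
by rewrite !ge0_pricing_op//.
Qed.

End eigen_measure.

(** * Transfer of the ergodic bound to the pricing operator *)

Theorem theorem3p4 (R : realType) (E : ptopologicalType)
    (d : measure_display) (Omega : measurableType d)
    (X : R -> Omega -> E) (theta : R -> Omega -> Omega)
    (P : E -> probability Omega R) (S : R -> Omega -> R)
    (E_lusin : lusin R E) (E_two : exists x y : E, x <> y)
    (X_right : borel_right_process X theta P)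
    (S_kernel : pricing_kernel X theta P S)
    (piR : E -> R) (lambdaR : R)
    (piR_eigen : positive_eigenfunction X P S piR lambdaR)
    (Q : E -> probability (raw_space X) R)
    (Q_eigen : eigen_measure P S piR lambdaR Q)
    (Q_recurrent : recurrent Q)
    (varsigma : probability (borel E) R) (beta : E -> R) (alpha t0 : R)
    (beta_borel : measurable_fun [set: borel E] (beta : borel E -> R))
    (alpha_gt0 : 0 < alpha) (t0_gt0 : 0 < t0)
    (ergodic : forall f : E -> R,
      measurable_fun [set: borel E] (f : borel E -> R) ->
      [bounded f x | x in [set: E]] ->
      forall t x, t0 <= t ->
      (`| \int[Q x]_w (f (X t w) / piR (X t w))%:E
          - limit_coef piR varsigma f |
       <= (beta x * supnorm f * expR (- (alpha * t)))%:E)%E)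
    (f : E -> R) (f_borel : measurable_fun [set: borel E] (f : borel E -> R))
    (f_bounded : [bounded f x | x in [set: E]])
    (x : E) (t : R) (t_ge : t0 <= t) :
  (`| pricing_op X P S t f x
      - limit_coef piR varsigma f * (expR (- (lambdaR * t)) * piR x)%:E |
   <= (beta x * piR x * supnorm f * expR (- ((lambdaR + alpha) * t)))%:E)%E.
Proof.
have t_ge0 : 0 <= t := ltW (lt_le_trans t0_gt0 t_ge).
have [_ pi0 _] := piR_eigen.
have fin_integral (g : E -> R) :
    measurable_fun [set: borel E] (g : borel E -> R) ->
    [bounded g x | x in [set: E]] ->
    (\int[Q x]_w (g (X t w) / piR (X t w))%:E \is a fin_num)%E.
  (* The bound is a real number, whereas an infinite integral makes the left side [+oo], even for
     [oo - oo], whose conventional value is [-oo]. *)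
  move=> mg g_bounded; have := ergodic g mg g_bounded t x t_ge.
  case: (\int[Q x]_w _)%E => [a||]; case: (limit_coef _ _ _) => [c||] //=;
    by rewrite leye_eq.
have f_pos_bounded : [bounded f^\+ y | y in [set: E]].
  move: f_bounded => [M [Mreal fM]]; exists M; split=> // r Mr y _ /=.
  rewrite (le_trans _ (fM _ Mr y I))// ger0_norm ?funrpos_ge0//.
  by rewrite /funrpos ge_max ler_norm normr_ge0.
(* The hypothesis applied to [f^+] excludes [oo - oo] in the integral of [f]. *)
have finp := fin_integral f^\+ (measurable_funrpos f_borel) f_pos_bounded.
have finf := fin_integral f f_borel f_bounded.
rewrite (pricing_op_eigen_measure E_lusin X_right S_kernel piR_eigen Q_eigen)//.
have k0 : 0 <= expR (- (lambdaR * t)) * piR x.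
  by rewrite mulr_ge0 ?expR_ge0 ?ltW.
(* Finiteness of the integral of [f] ([finf]) lets the common factor leave the difference; by [k0]
   it also leaves the absolute value. *)
rewrite [(limit_coef _ _ _ * _)%E]muleC -muleBr//; last first.
  exact: fin_num_adde_defr.
rewrite abseM gee0_abs ?lee_fin//.
apply: (le_trans (lee_wpmul2l _ (ergodic f f_borel f_bounded t x t_ge))).
  by rewrite lee_fin.
rewrite -EFinM lee_fin mulrDl opprD expRD le_eqVlt; apply/orP; left.
by apply/eqP; ring.
Qed.
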